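(* Let $k\geqslant 1$ be an integer, and let $G=(V(G),E(G))$ and $H=(V(G),E(H))$ be graphs on the same vertex set, with $|V(G)|\geqslant k$ and $E(G)\subseteq E(H)$. Then $$\gamma_{k\text{-SRD}}(H)\leqslant\gamma_{k\text{-SRD}}(G).$$
   Context: All graphs are finite, simple and undirected; $N(v)$ denotes the set of neighbors of $v$ and $\Delta(G)$ the maximum degree. Let $k\geqslant 1$ be an integer with $|V(G)|\geqslant k$. An attack pattern is a set $P\subseteq V(G)$ with $|P|=k$. A function $f:V(G)\to\{0,1,\ldots,\min(\Delta(G),k)+1\}$ is a proper $k$-SRD ($k$-strong Roman domination) function if for each attack pattern $P$ every vertex $u\in P$ with $f(u)=0$ can be defended by a neighboring vertex, where each vertex $v$ with $f(v)\geqslant 2$ can defend at most $f(v)-1$ of its neighbors in $P$ labeled 0 (and vertices with label $\leqslant 1$ defend no other vertex). That is, for each $P$ there is a map $\delta_P:\{u\in P : f(u)=0\}\to V(G)$ (which may depend on $P$) such that $\delta_P(u)\in N(u)$ and $f(\delta_P(u))\geqslant 2$ for all $u$ in its domain, and $|\delta_P^{-1}(v)|\leqslant f(v)-1$ for every $v$ with $f(v)\geqslant 2$. The weight is $\omega(f)=\sum_{v\in V(G)}f(v)$, and the $k$-SRD number is $\gamma_{k\text{-SRD}}(G)=\min\{\omega(f) : f \text{ is a proper } k\text{-SRD function on } G\}$. *)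

(* Defs.v *)
From mathcomp Require Import all_boot.

Set Implicit Arguments.
Unset Strict Implicit.
Unset Printing Implicit Defensive.

(* A finite simple graph on the vertex type T is given by its adjacency
   relation e : rel T, assumed symmetric and irreflexive where it is used. *)

Section StrongRomanDomination.

Variables (T : finType) (k : nat) (e : rel T).

Definition nbrs (v : T) : {set T} := [set u | e v u].

Definition max_degree : nat := \max_(v : T) #|nbrs v|.

(* The ordinal type encodes the label set {0, 1, ..., min(Delta, k) + 1}. *)
Definition labelling := {ffun T -> 'I_(minn max_degree k).+2}.

Definition weight (f : labelling) : nat := \sum_(v : T) f v.

Definition attacked0 (f : labelling) (P : {set T}) : {set T} :=
  [set u in P | f u == 0 :> nat].

(* The map delta_P is represented by a total d : T -> T; its values outside
   attacked0 f P are irrelevant, and fibres are taken inside attacked0 f P. *)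
Definition defence (f : labelling) (P : {set T}) (d : {ffun T -> T}) : bool :=
  [forall u in attacked0 f P, (d u \in nbrs u) && (2 <= f (d u))] &&
  [forall v : T, (2 <= f v) ==>
     (#|[set u in attacked0 f P | d u == v]| <= f v - 1)].

Definition proper_SRD (f : labelling) : bool :=
  [forall P : {set T}, (#|P| == k) ==> [exists d, defence f P d]].

Definition SRD_weight (n : nat) : bool :=
  [exists f : labelling, proper_SRD f && (weight f == n)].

Lemma ex_SRD_weight : exists n, SRD_weight n.
Proof.
pose f : labelling := [ffun=> inord 1].
have f1 v : f v = 1 :> nat by rewrite ffunE inordK.
exists (weight f); apply/existsP; exists f; rewrite eqxx andbT.
apply/forallP => P; apply/implyP => _; apply/existsP; exists [ffun v => v].
apply/andP; split; apply/forallP => v; first by rewrite inE f1 andbF.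
by rewrite f1.
Qed.

Definition SRD_number : nat := ex_minn ex_SRD_weight.

End StrongRomanDomination.

(* Main.v *)
Require Import Defs.
From mathcomp Require Import all_boot.

(** A minimum-weight labelling for [eG] stays proper for [eH] with the same defence maps: the
    vertices labelled 0 are the same, defenders remain neighbours when edges are added, and
    capacities depend only on labels ([proper_SRD_sub]). Its labels stay admissible because the
    bound on them grows with the maximum degree ([max_degree_sub]). *)

Lemma nbrs_sub (T : finType) (eG eH : rel T) :
  (forall x y, eG x y -> eH x y) -> forall v, nbrs eG v \subset nbrs eH v.
Proof. by move=> sGH v; apply/subsetP => u; rewrite !inE; apply: sGH. Qed.

Lemma max_degree_sub (T : finType) (eG eH : rel T) :
  (forall x y, eG x y -> eH x y) -> max_degree eG <= max_degree eH.
Proof.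
move=> sGH; apply/bigmax_leqP => v _.
exact: leq_trans (subset_leq_card (nbrs_sub _ _ _ sGH v)) (leq_bigmax v).
Qed.

(* The codomains of [f] and [g] are different ordinal types, so the two
   labellings are compared through their values in [nat]. *)
Lemma proper_SRD_sub (T : finType) (k : nat) (eG eH : rel T)
    (f : labelling k eG) (g : labelling k eH) :
  (forall x y, eG x y -> eH x y) -> (forall v, g v = f v :> nat) ->
  proper_SRD f -> proper_SRD g.
Proof.
move=> sGH gf /forallP pf; apply/forallP => P; apply/implyP => cardP.
have /existsP[d /andP[/forallP d_nbr /forallP d_cap]] := implyP (pf P) cardP.
have att : attacked0 g P = attacked0 f P.
  by apply/setP => u; rewrite !inE gf.
apply/existsP; exists d; rewrite /defence att.
apply/andP; split; apply/forallP => v; rewrite gf; last exact: d_cap.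
apply/implyP => /(implyP (d_nbr v)) /andP[d_v ->]; rewrite andbT.
exact: (subsetP (nbrs_sub _ _ _ sGH v)).
Qed.

Theorem lemma2 (k : nat) (T : finType) (eG eH : rel T)
    (k_ge1 : 1 <= k) (k_leT : k <= #|T|)
    (symG : symmetric eG) (irrG : irreflexive eG)
    (symH : symmetric eH) (irrH : irreflexive eH)
    (subGH : forall x y : T, eG x y -> eH x y) :
  SRD_number k eH <= SRD_number k eG.
Proof.
rewrite {2}/SRD_number; case: ex_minnP => n /existsP[f /andP[pf /eqP <-]] _.
(* By minimality of [m], it suffices that the weight of [f] is attained by a proper labelling for
   [eH]. *)
rewrite /SRD_number; case: ex_minnP => m _; apply.
have le_lab : (minn (max_degree eG) k).+2 <= (minn (max_degree eH) k).+2.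
  by rewrite !ltnS leq_min geq_minr geq_min (max_degree_sub _ _ _ subGH).
pose g : labelling k eH := [ffun v => widen_ord le_lab (f v)].
have gf v : g v = f v :> nat by rewrite ffunE.
apply/existsP; exists g; rewrite (proper_SRD_sub _ _ _ _ f) //=.
by apply/eqP; apply: eq_bigr => v _; apply: gf.
Qed.
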